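(* Let $\widehat\Delta : \mathbb{C} \to \mathbb{C}$ be defined by $$\widehat\Delta(z) = z^2 - 4z + 6 - e^{-z} (2 z + 6) .$$ Let $z_0 \in \mathbb{C}$ be a root of $\widehat\Delta$ with $\operatorname{Re} z_0 \geq 0$. Then $|\operatorname{Im} z_0| < 2 \pi$. *)

(* Defs.v *)
From Stdlib Require Import Reals.
From Coquelicot Require Import Coquelicot.
Open Scope R_scope.
Open Scope C_scope.

(* Euler's formula: exp (x + i y) = e^x (cos y + i sin y). *)
Definition Cexp (z : C) : C :=
  RtoC (exp (Re z)) * (cos (Im z), sin (Im z)).

Lemma Cexp_RtoC (x : R) : Cexp (RtoC x) = RtoC (exp x).
Proof.
unfold Cexp; simpl; rewrite cos_0, sin_0.
apply injective_projections; simpl; ring.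
Qed.

Lemma Cexp_plus (z w : C) : Cexp (z + w) = Cexp z * Cexp w.
Proof.
destruct z as [a b], w as [c d]; unfold Cexp; simpl.
rewrite exp_plus, cos_plus, sin_plus.
apply injective_projections; simpl; ring.
Qed.

Definition Delta_hat (z : C) : C :=
  z ^ 2 - 4 * z + 6 - Cexp (- z) * (2 * z + 6).

(* Main.v *)
Require Import Defs.
From Stdlib Require Import Reals Lra.
From Coquelicot Require Import Coquelicot.

(** At a root, [z ^ 2 - 4 z + 6 = exp (- z) (2 z + 6)].  In the closed right
    half-plane [exp (- z)] has modulus at most 1, so the quadratic polynomial
    is at most the affine one in modulus.  The quadratic wins as soon as the
    imaginary part is large: [quadratic_dominates_affine] shows that the
    inequality already fails for [|Im z| >= 4], uniformly in [Re z].  As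
    [2 < PI], the bound [2 PI] follows with room to spare. *)

Lemma Cmod_Cexp (z : C) : Cmod (Cexp z) = exp (Re z).
Proof.
unfold Cexp; rewrite Cmod_mult, Cmod_R, Rabs_pos_eq
  by (left; apply exp_pos).
replace (Cmod _) with 1%R; [ring|].
unfold Cmod; simpl.
replace (_ + _)%R with 1%R; [now rewrite sqrt_1|].
generalize (sin2_cos2 (Im z)); unfold Rsqr; lra.
Qed.

(** With [u = x - 2], so that [z ^ 2 - 4 z + 6 = (z - 2) ^ 2 + 2], the
    difference of the squared moduli is
    [(u ^ 2 + y ^ 2) ^ 2 - 8 y ^ 2 - 40 u - 96].  For [y ^ 2 >= 16] its first
    term is at least [16 (u ^ 2 + y ^ 2)], which leaves at least
    [16 u ^ 2 - 40 u + 32], a quadratic of negative discriminant. *)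
Lemma quadratic_dominates_affine (z : C) :
  (4 <= Rabs (Im z))%R -> (Cmod (2 * z + 6) < Cmod (z ^ 2 - 4 * z + 6))%R.
Proof.
destruct z as [x y]; simpl; intros hy.
assert (hY : (16 <= y ^ 2)%R) by (rewrite <- pow2_abs; nra).
unfold Cmod; apply sqrt_lt_1_alt; simpl; split; [nra|].
apply Rlt_0_minus.
set (u := (x - 2)%R).
match goal with |- (0 < ?d)%R =>
  replace d with ((u ^ 2 + y ^ 2) ^ 2 - 8 * y ^ 2 - 40 * u - 96)%R
    by (unfold u; ring)
end.
assert (hS : (16 * (u ^ 2 + y ^ 2) <= (u ^ 2 + y ^ 2) ^ 2)%R)
  by (assert (h := pow2_ge_0 u); nra).
(* complete the square: 16 u ^ 2 - 40 u + 32 = (4 u - 5) ^ 2 + 7 *)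
assert (h := pow2_ge_0 (4 * u - 5)); nra.
Qed.

Theorem lemma5 (z0 : C) (hroot : Delta_hat z0 = RtoC 0%R)
    (hRe : (0 <= Re z0)%R) :
  (Rabs (Im z0) < 2 * PI)%R.
Proof.
assert (heq : (z0 ^ 2 - 4 * z0 + 6 = Cexp (- z0) * (2 * z0 + 6))%C).
{ rewrite <- (Cplus_0_r (Cexp _ * _)%C), <- hroot; unfold Delta_hat; ring. }
assert (hle : (Cmod (z0 ^ 2 - 4 * z0 + 6) <= Cmod (2 * z0 + 6))%R).
{ rewrite heq, Cmod_mult, Cmod_Cexp.
  rewrite <- (Rmult_1_l (Cmod (2 * z0 + 6))) at 2.
  apply Rmult_le_compat_r; [apply Cmod_ge_0|].
  rewrite <- exp_0; apply Rnot_lt_le; intros h; apply exp_lt_inv in h.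
  destruct z0; simpl in *; lra. }
assert (hPI := PI2_1).
apply Rnot_le_lt; intros hIm.
assert (h := quadratic_dominates_affine z0); lra.
Qed.
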